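(* Let $(\Omega,\Sigma,\Pr)$ be a probability space and let $A_i\in\Sigma$ for $i\in\mathbb{N}$. For $k\in\mathbb{N}$ let $$S_k:=\sum_{1\le i_1<\cdots<i_k}\Pr(A_{i_1}\cap\cdots\cap A_{i_k})\in[0,\infty].$$ Fix $k\in\mathbb{N}$. Then the identity $$\Pr\Big(\bigcup_{1\le i_1<\cdots<i_k}(A_{i_1}\cap\cdots\cap A_{i_k})\Big)=\sum_{j\in\mathbb{Z}_+}(-1)^j\binom{j+k-1}{k-1}S_{j+k}$$ holds (with all $S_l$ finite and the series convergent) if and only if $S_l\in[0,\infty)$ for all $l\in\mathbb{N}$ and $\lim_{l\to\infty}l^{k-1}S_l=0$.
   Context: $\mathbb{N}$ denotes the positive integers and $\mathbb{Z}_+$ the nonnegative integers. The union on the left is over all strictly increasing $k$-tuples of positive integers. *)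

(* Defs.v *)
From HB Require Import structures.
From mathcomp Require Import all_boot all_order all_algebra.
From mathcomp Require Import all_classical all_reals all_analysis.
Set Implicit Arguments. Unset Strict Implicit. Unset Printing Implicit Defensive.
Import Order.TTheory GRing.Theory Num.Theory numFieldNormedType.Exports.
Local Open Scope classical_set_scope.
Local Open Scope ring_scope.

Definition incr_tuples (k : nat) : set (k.-tuple nat) :=
  [set t | sorted ltn t /\ all (fun i => 0 < i)%N t].
Arguments incr_tuples k : clear implicits.

Definition tuple_inter {T : Type} (A : nat -> set T) {k : nat} (t : k.-tuple nat) : set T :=
  \big[setI/setT]_(i <- t) A i.

Definition Sk {d : measure_display} {T : measurableType d} {R : realType}
  (P : probability T R) (A : nat -> set T) (k : nat) : \bar R :=
  \esum_(t in incr_tuples k) P (tuple_inter A t).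

Definition atleast_k {T : Type} (A : nat -> set T) (k : nat) : set T :=
  \bigcup_(t in incr_tuples k) tuple_inter A t.

(* Main.v *)
Require Import Defs.
From HB Require Import structures.
From mathcomp Require Import all_boot all_order all_algebra.
From mathcomp Require Import zify ring.
From mathcomp Require Import all_classical all_reals all_analysis.
Import Order.TTheory GRing.Theory Num.Theory numFieldNormedType.Exports.

(* Truncate to the events A 1, ..., A n.+1. Each outcome then lies in exactly one atom,
   indexed by the set U of those events that occur; on that atom the indicator
   of "at least k events" is [k <= #|U|] and the tuple sum S_l counts 'C(#|U|, l).
   The signed remainder of the Bonferroni-type sum
     [k <= r] - \sum_(j < J) (-1)^j 'C(j + k - 1, k - 1) 'C(r, j + k)
   is nondecreasing in r and vanishes at r = 0, so its absolute value is at most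
   the next term 'C(J + k - 1, k - 1) 'C(r, J + k).  Summing over the atoms and
   letting n grow (monotone convergence) bounds the error of the J-th partial
   sum by 'C(J + k - 1, k - 1) S_(J + k), which is comparable to
   (J + k)^(k - 1) S_(J + k).  This gives the "if" direction; conversely the
   terms of a convergent series tend to 0. *)

Lemma card_ltn_sorted_tuples_sub m n (U : {set 'I_n}) :
  #|[set t : m.-tuple 'I_n | sorted ltn (map val t) && ([set i in t] \subset U)]|
  = 'C(#|U|, m).
Proof.
have [n0 | n_gt0] := posnP n.
  subst n; have -> : #|U| = 0 by apply/eqP; rewrite -leqn0 (leq_trans (max_card U)) ?card_ord.
  case: m => [|m]; last by apply: fintype.eq_card0; case/tupleP=> [[]].
  apply: (@fintype.eq_card1 _ [tuple]) => t; rewrite [t]tuple0 !inE /=.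
  by apply/fintype.subsetP => -[].
pose i0 := Ordinal n_gt0.
rewrite -cards_draws.
pose f_t (t : m.-tuple 'I_n) := [set i in t].
pose f_A (A : {set 'I_n}) := [tuple of mkseq (nth i0 (enum A)) m].
have val_fA (A : {set 'I_n}) : #|A| = m -> val (f_A A) = enum A.
  by move=> Am; rewrite -[enum _](mkseq_nth i0) -cardE Am.
have inc_A (A : {set 'I_n}) : sorted ltn (map val (enum A)).
  rewrite -[enum _](eq_filter (mem_enum _)).
  rewrite -(eq_filter (mem_map val_inj _)) -filter_map.
  by rewrite (sorted_filter ltn_trans) // unlock val_ord_enum iota_ltn_sorted.
rewrite -!sum1dep_card (reindex_onto f_t f_A) /= => [|A]; last first.
  case/andP=> _ /eqP cardAm.
  by apply/setP=> x; rewrite inE -(mem_enum A) -val_fA.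
apply: eq_bigl => t.
case: (boolP (f_t t \subset U)) => sub; rewrite ?andbT ?andbF //=.
apply/idP/idP => [inc_t|/andP [/eqP t_m /eqP <-]]; last by rewrite val_fA.
have ft_m : #|f_t t| = m.
  rewrite cardsE (card_uniqP _) ?size_tuple // -(map_inj_uniq val_inj).
  exact: (sorted_uniq ltn_trans ltnn).
rewrite ft_m eqxx -val_eqE val_fA // -(inj_eq (inj_map val_inj)) /=.
apply/eqP/(irr_sorted_eq ltn_trans ltnn) => // y.
by apply/mapP/mapP=> [] [x t_x ->]; exists x; rewrite // mem_enum inE in t_x *.
Qed.

Lemma ffactD n m p : n ^_ (m + p) = n ^_ m * (n - m) ^_ p.
Proof.
elim: p => [|p IHp]; first by rewrite addn0 muln1.
by rewrite addnS !ffactnSr IHp subnDA mulnA.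
Qed.

Lemma mul_bin_nested r a b : b <= a ->
  'C(r, a) * 'C(a, b) = 'C(r, b) * 'C(r - b, a - b).
Proof.
move=> le_ba; have fact_gt0' : 0 < b`! * (a - b)`! by rewrite muln_gt0 !fact_gt0.
apply/eqP; rewrite -(eqn_pmul2r fact_gt0').
rewrite -mulnA bin_fact // bin_ffact mulnACA !bin_ffact -ffactD subnKC //.
Qed.

Lemma bin_le_expn j K : 'C(j + K, K) <= (j + K.+1) ^ K.
Proof.
apply: leq_trans (leq_pmulr _ (fact_gt0 K)) _.
rewrite bin_ffact ffact_prod -[_ ^ K]muln1 -iter_muln -big_const_ord.
by apply: leq_prod => i _; lia.
Qed.

Lemma expn_le_bin j K : (j + K.+1) ^ K <= K.+1 ^ K * K`! * 'C(j + K, K).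
Proof.
rewrite -mulnA [K`! * _]mulnC bin_ffact ffact_prod.
rewrite -[_ ^ K]muln1 -[K.+1 ^ K]muln1 -!iter_muln -!big_const_ord -big_split /=.
by apply: leq_prod => i _; have := ltn_ord i; nia.
Qed.

Local Open Scope ring_scope.

Lemma alternating_bin_sum (R : comPzRingType) b J :
  \sum_(0 <= j < J.+1) (-1) ^+ j * 'C(b.+1, j)%:R = (-1) ^+ J * 'C(b, J)%:R :> R.
Proof.
elim: J => [|J IHJ]; first by rewrite big_nat1 !bin0 expr0 mul1r.
by rewrite big_nat_recr //= IHJ binS natrD exprS; ring.
Qed.

Section BonferroniRemainder.
Variables (R : numDomainType) (K : nat).

Definition bonferroni_sum J r : R :=
  \sum_(0 <= j < J) (-1) ^+ j * 'C(j + K, K)%:R * 'C(r, j + K.+1)%:R.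

Definition bonferroni_rem J r : R := (-1) ^+ J * (((K < r)%N)%:R - bonferroni_sum J r).

Lemma bonferroni_remS J r :
  bonferroni_rem J.+1 r = 'C(J + K, K)%:R * 'C(r, J + K.+1)%:R - bonferroni_rem J r.
Proof.
rewrite -[in RHS](signrMK J ('C(J + K, K)%:R * _)).
by rewrite /bonferroni_rem /bonferroni_sum big_nat_recr //= exprS; ring.
Qed.

Lemma bonferroni_sumSr J r : bonferroni_sum J r.+1 =
  bonferroni_sum J r + 'C(r, K)%:R * \sum_(0 <= j < J) (-1) ^+ j * 'C(r - K, j)%:R.
Proof.
rewrite /bonferroni_sum big_distrr -big_split /=; apply: eq_bigr => j _.
rewrite addnS binS natrD mulrDr; congr (_ + _).
have := mul_bin_nested r _ _ (leq_addl j K); rewrite addnK => binE.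
by rewrite mulrCA -mulrA -natrM mulnC binE natrM; ring.
Qed.

Lemma bonferroni_remSr J r : bonferroni_rem J.+1 r.+1 =
  bonferroni_rem J.+1 r + ((K < r) * 'C(r, K) * 'C(r - K.+1, J))%N%:R.
Proof.
rewrite /bonferroni_rem bonferroni_sumSr.
case: (ltngtP r K) => [lt_rK | lt_Kr | ->].
- by rewrite bin_small // ltnS leqNgt lt_rK /=; ring.
- have [b def_b] : exists b, (r - K = b.+1)%N by exists (r - K).-1; rewrite prednK ?subn_gt0.
  have -> : (r - K.+1 = b)%N by rewrite subnS def_b.
  rewrite def_b alternating_bin_sum ltnS (ltnW lt_Kr) /= mul1n natrM.
  by rewrite -[in RHS](signrMK J 'C(b, J)%:R) exprS; ring.
- rewrite ltnSn binn subnn big_nat_recl //= big1 => [|j _]; last by rewrite bin0n mulr0.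
  by rewrite bin0 expr0; ring.
Qed.

Lemma bonferroni_rem_ge0 J r : 0 <= bonferroni_rem J r.
Proof.
case: J => [|J]; first by rewrite /bonferroni_rem /bonferroni_sum big_nil subr0 mul1r.
elim: r => [|r IHr]; last by rewrite bonferroni_remSr addr_ge0.
rewrite /bonferroni_rem /bonferroni_sum big1 ?subr0 ?mulr0 // => j _.
by rewrite bin0n addnS mulr0.
Qed.

Lemma bonferroni_ineq J r :
  `|((K < r)%N)%:R - bonferroni_sum J r| <= 'C(J + K, K)%:R * 'C(r, J + K.+1)%:R.
Proof.
have -> : ((K < r)%N)%:R - bonferroni_sum J r = (-1) ^+ J * bonferroni_rem J r.
  by rewrite /bonferroni_rem signrMK.
rewrite normrM normr_sign mul1r ger0_norm ?bonferroni_rem_ge0 //.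
by rewrite -subr_ge0 -bonferroni_remS bonferroni_rem_ge0.
Qed.

End BonferroniRemainder.

Local Open Scope classical_set_scope.

Lemma nondecreasing_bigcup_finite_sub (I : choiceType) (F : nat -> set I) (X : set I) :
  nondecreasing_seq F -> finite_set X -> X `<=` \bigcup_n F n ->
  exists n, X `<=` F n.
Proof.
move=> ndF /finite_fsetP[B ->] {X}.
suff seq_sub (s : seq I) : [set` s] `<=` \bigcup_n F n -> exists n, [set` s] `<=` F n.
  exact: (seq_sub (finmap.enum_fset B)).
elim: s => [|x s IHs] sub; first by exists 0%N.
have [m _ Fmx] := sub x (mem_head x s).
have [n sFn] : exists n, [set` s] `<=` F n.
  by apply: IHs => y ys; apply: sub; rewrite /= in_cons ys orbT.
exists (maxn m n) => y /=; rewrite in_cons => /orP[/eqP -> | ys].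
  by have /subsetPset := ndF _ _ (leq_maxl m n); apply.
by have /subsetPset := ndF _ _ (leq_maxr m n); apply; apply: sFn.
Qed.

Lemma fsum_cvg_esum (R : realType) (I : choiceType) (S : set I) (F : nat -> set I)
    (a : I -> \bar R) :
  (forall i, S i -> 0 <= a i)%E -> (forall n, finite_set (F n)) -> nondecreasing_seq F ->
  \bigcup_n F n = S -> (fun n => \sum_(i \in F n) a i)%E @ \oo --> \esum_(i in S) a i.
Proof.
move=> a_ge0 finF ndF FS.
have FnS n : F n `<=` S by rewrite -FS => i Fni; exists n.
have le_fsum X Y : finite_set X -> finite_set Y -> X `<=` Y -> Y `<=` S ->
    (\sum_(i \in X) a i <= \sum_(i \in Y) a i)%E.
  move=> finX finY XY YS; apply: lee_fsum_nneg_subset => // [i|i].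
    by rewrite !inE => /XY.
  by rewrite !inE => /andP[_]; rewrite inE => /YS /a_ge0.
suff <- : ereal_sup (range (fun n => \sum_(i \in F n) a i)%E) = \esum_(i in S) a i.
  apply: ereal_nondecreasing_cvgn => n m le_nm.
  by apply: le_fsum => //; apply/subsetPset/ndF.
apply/le_anti/andP; split.
  by apply: ge_ereal_sup => _ [n _ <-]; apply: esum_ge; exists (F n).
apply: ge_ereal_sup => _ [X [finX XS] <-].
have [n XFn] : exists n, X `<=` F n.
  by apply: nondecreasing_bigcup_finite_sub; rewrite ?FS.
apply: le_trans (le_fsum _ _ finX (finF n) XFn (FnS n)) _.
by apply: ereal_sup_ubound; exists n.
Qed.

Lemma in_bigsetI_seq (I : choiceType) (T : Type) (F : I -> set T) (s : seq I) x :
  (\big[setI/setT]_(i <- s) F i) x <-> (forall i, i \in s -> F i x).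
Proof. by rewrite -bigcap_seq. Qed.

Section Truncation.
Context {d} {T : measurableType d} {R : realType} (P : probability T R) (A : nat -> set T).
Hypothesis mA : forall i, measurable (A i).

Definition pr (X : set T) : R := fine (P X).

Lemma prE X : measurable X -> P X = (pr X)%:E.
Proof. by move=> mX; rewrite /pr fineK // fin_num_measure. Qed.

Lemma pr_ge0 X : 0 <= pr X.
Proof. exact: fine_ge0. Qed.

Lemma measurable_tuple_inter {l} (t : l.-tuple nat) : measurable (tuple_inter A t).
Proof. exact: bigsetI_measurable. Qed.

Definition succ_tuple {n l} (t : l.-tuple 'I_n.+1) : l.-tuple nat :=
  map_tuple (fun i : 'I_n.+1 => (val i).+1) t.

Definition incr_ord_tuple {n l} (t : l.-tuple 'I_n.+1) := sorted ltn (map val t).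

Definition incr_tuples_le n l : set (l.-tuple nat) :=
  [set t | incr_tuples l t /\ all (fun i => i <= n.+1)%N t].

Lemma succ_tuple_inj n l : injective (@succ_tuple n l).
Proof.
move=> t1 t2 /(congr1 val) /inj_map eq_t; apply/val_inj/eq_t.
by move=> i j /succn_inj /val_inj.
Qed.

Lemma incr_tuples_leE n l :
  incr_tuples_le n l = succ_tuple @` [set t : l.-tuple 'I_n.+1 | incr_ord_tuple t].
Proof.
apply/seteqP; split => [t [[t_incr t_pos] t_le] | _ [t t_incr <-]].
  pose t' := map_tuple (fun i => inord i.-1 : 'I_n.+1) t.
  have t'E : succ_tuple t' = t.
    apply: val_inj; rewrite /= -map_comp; apply: map_id_in => i it /=.
    have /allP/(_ i it) := t_pos; have /allP/(_ i it) := t_le.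
    by move=> le_i_n i_gt0; rewrite inordK ?prednK //; lia.
  clearbody t'; subst t; exists t' => //.
  by move: t_incr; rewrite /incr_ord_tuple /= !sorted_map.
split; first split.
- by move: t_incr; rewrite /incr_ord_tuple /= !sorted_map.
- by apply/allP => _ /mapP[i _ ->].
- by apply/allP => _ /mapP[i _ ->]; apply: ltn_ord.
Qed.

Lemma finite_incr_tuples_le n l : finite_set (incr_tuples_le n l).
Proof. by rewrite incr_tuples_leE; apply/finite_image/finite_finset. Qed.

Lemma nondecreasing_incr_tuples_le l : nondecreasing_seq (incr_tuples_le ^~ l).
Proof.
move=> n m le_nm; apply/subsetPset => t [t_incr /allP t_le]; split => //.
by apply/allP => i /t_le /leq_trans; apply.
Qed.

Lemma bigcup_incr_tuples_le l : \bigcup_n incr_tuples_le n l = incr_tuples l.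
Proof.
apply/seteqP; split => [t [n _ []] // | t t_incr].
exists (\max_(i <- t) i)%N => //; split => //; apply/allP => i it.
by apply: leqW; apply: (@leq_bigmax_seq _ _ xpredT id).
Qed.

Definition Sk_trunc n l : R :=
  \sum_(t : l.-tuple 'I_n.+1 | incr_ord_tuple t) pr (tuple_inter A (succ_tuple t)).

Lemma fsum_incr_tuples_le n l :
  (\sum_(t \in incr_tuples_le n l) P (tuple_inter A t))%E = (Sk_trunc n l)%:E.
Proof.
rewrite incr_tuples_leE fsbig_image; last by move=> ? ? _ _; apply: succ_tuple_inj.
rewrite -(bigfs _ (r := index_enum _)) ?index_enum_uniq //; last first.
  by move=> t _; rewrite mem_index_enum.
rewrite /Sk_trunc -sumEFin; apply: eq_bigr => t _.
exact/prE/measurable_tuple_inter.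
Qed.

Lemma Sk_trunc_cvg l : Sk P A l \is a fin_num -> Sk_trunc ^~ l @ \oo --> fine (Sk P A l).
Proof.
move=> Sk_fin.
suff : (fun n => (Sk_trunc n l)%:E) @ \oo --> Sk P A l by rewrite -(fineK Sk_fin) => /fine_cvg.
under eq_fun do rewrite -fsum_incr_tuples_le.
apply: fsum_cvg_esum.
- by move=> t _; apply: measure_ge0.
- by move=> n; apply: finite_incr_tuples_le.
- exact: nondecreasing_incr_tuples_le.
- exact: bigcup_incr_tuples_le.
Qed.

Definition trace n (x : T) : {set 'I_n.+1} := [set i : 'I_n.+1 | `[< A i.+1 x >]].

Definition atom n (U : {set 'I_n.+1}) : set T := [set x | trace n x = U].

Lemma in_trace n x (i : 'I_n.+1) : (i \in trace n x) = `[< A i.+1 x >].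
Proof. by rewrite inE. Qed.

Lemma measurable_atom n U : measurable (atom n U).
Proof.
suff -> : atom n U = \big[setI/setT]_(i : 'I_n.+1) if i \in U then A i.+1 else ~` A i.+1.
  by apply: bigsetI_measurable => i _; case: ifP => _; [|apply: measurableC]; apply: mA.
apply/seteqP; split => x.
  by move=> /= <-; apply/in_bigsetI_seq => i _; rewrite in_trace; case: asboolP.
move=> /in_bigsetI_seq Ux; apply/setP => i; rewrite in_trace.
by have := Ux i (mem_index_enum i); case: (i \in U) => Uix; [apply/asboolP | apply/asboolPn].
Qed.

Lemma pr_sum_atoms n X : measurable X ->
  pr X = \sum_(U : {set 'I_n.+1}) pr (X `&` atom n U).
Proof.
move=> mX; have mXU U : measurable (X `&` atom n U).
  by apply: measurableI => //; apply: measurable_atom.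
have XE : X = \bigcup_(U in [set` predT]) (X `&` atom n U).
  by apply/seteqP; split => [x Xx | x [U _ []]] //; exists (trace n x).
have atoms_disj : trivIset [set` predT] (fun U => X `&` atom n U).
  by move=> U V _ _ [x [[_ <-] [_ <-]]].
have := measure_fin_bigcup P finite_finset atoms_disj (fun U _ => mXU U).
rewrite -XE -(bigfs _ (r := index_enum _)) ?index_enum_uniq // => [PX | U _]; last first.
  by rewrite mem_index_enum.
by apply: EFin_inj; rewrite -prE // PX -sumEFin; apply: eq_bigr => U _; apply/prE.
Qed.

Lemma tuple_inter_atom n l (t : l.-tuple 'I_n.+1) U :
  tuple_inter A (succ_tuple t) `&` atom n U =
  if [set i in t] \subset U then atom n U else set0.
Proof.
have interE x : tuple_inter A (succ_tuple t) x <-> {subset t <= trace n x}.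
  rewrite /tuple_inter in_bigsetI_seq; split => [inter_x i it | sub _ /mapP[i it ->]].
    by rewrite in_trace; apply/asboolP/inter_x/map_f.
  by have := sub i it; rewrite in_trace => /asboolP.
apply/seteqP; split => [x [/interE t_sub Ux] | x].
  suff -> : [set i in t] \subset U by [].
  by apply/fintype.subsetP => i; rewrite inE -Ux; apply: t_sub.
case: ifP => [/fintype.subsetP t_sub Ux | _ []] //; split => //.
by apply/interE => i it; rewrite Ux; apply: t_sub; rewrite inE.
Qed.

Lemma Sk_trunc_atoms n l :
  Sk_trunc n l = \sum_(U : {set 'I_n.+1}) pr (atom n U) * 'C(#|U|, l)%:R.
Proof.
rewrite /Sk_trunc.
under eq_bigr => t _ do rewrite (pr_sum_atoms n _ (measurable_tuple_inter _)).
rewrite exchange_big /=; apply: eq_bigr => U _.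
under eq_bigr => t _ do rewrite tuple_inter_atom.
transitivity
  (\sum_(t : l.-tuple 'I_n.+1 | incr_ord_tuple t && ([set i in t] \subset U)) pr (atom n U)).
  by rewrite big_mkcondr; apply: eq_bigr => t _; case: ifP; rewrite // /pr measure0.
rewrite -card_ltn_sorted_tuples_sub -sum1dep_card natr_sum big_distrr /=.
by apply: eq_bigr => t _; rewrite mulr1.
Qed.

Definition atleast_k_trunc n k : set T := \bigcup_(t in incr_tuples_le n k) tuple_inter A t.

Lemma measurable_atleast_k_trunc n k : measurable (atleast_k_trunc n k).
Proof.
apply: fin_bigcup_measurable; first exact: finite_incr_tuples_le.
by move=> t _; apply: measurable_tuple_inter.
Qed.

Lemma atleast_k_trunc_atom n k U :
  atleast_k_trunc n k `&` atom n U = if (k <= #|U|)%N then atom n U else set0.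
Proof.
have sub_tupleP : (exists2 t : k.-tuple 'I_n.+1, incr_ord_tuple t & [set i in t] \subset U)
    <-> (k <= #|U|)%N.
  rewrite -bin_gt0 -card_ltn_sorted_tuples_sub; split => [[t t_incr t_sub] | /card_gt0P[t]].
    by apply/card_gt0P; exists t; rewrite inE; apply/andP.
  by rewrite inE => /andP[]; exists t.
rewrite /atleast_k_trunc incr_tuples_leE; apply/seteqP; split => x.
  case=> -[_ [t t_incr <-] xt] Ux.
  have : (tuple_inter A (succ_tuple t) `&` atom n U) x by [].
  rewrite tuple_inter_atom; case: ifP => // t_sub _.
  suff /sub_tupleP -> : exists2 t : k.-tuple 'I_n.+1,
    incr_ord_tuple t & [set i in t] \subset U by [].
  by exists t.
case: ifP => [/sub_tupleP[t t_incr t_sub] Ux | _ []]; split => //.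
exists (succ_tuple t); first by exists t.
by have [] : (tuple_inter A (succ_tuple t) `&` atom n U) x by rewrite tuple_inter_atom t_sub.
Qed.

Lemma pr_atleast_k_trunc n k :
  pr (atleast_k_trunc n k) = \sum_(U : {set 'I_n.+1}) pr (atom n U) * ((k <= #|U|)%N)%:R.
Proof.
rewrite (pr_sum_atoms n _ (measurable_atleast_k_trunc n k)); apply: eq_bigr => U _.
by rewrite atleast_k_trunc_atom; case: ifP; rewrite ?mulr1 ?mulr0 // /pr measure0.
Qed.

Lemma bonferroni_trunc n K J :
  `|\sum_(0 <= j < J) (-1) ^+ j * 'C(j + K, K)%:R * Sk_trunc n (j + K.+1)%N
    - pr (atleast_k_trunc n K.+1)| <= 'C(J + K, K)%:R * Sk_trunc n (J + K.+1)%N.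
Proof.
have -> : \sum_(0 <= j < J) (-1) ^+ j * 'C(j + K, K)%:R * Sk_trunc n (j + K.+1)%N =
    \sum_(U : {set 'I_n.+1}) pr (atom n U) * bonferroni_sum R K J #|U|.
  under eq_bigr do rewrite Sk_trunc_atoms big_distrr.
  rewrite exchange_big /=; apply: eq_bigr => U _.
  by rewrite /bonferroni_sum big_distrr /=; apply: eq_bigr => j _; ring.
rewrite pr_atleast_k_trunc -sumrB Sk_trunc_atoms big_distrr /=.
apply: le_trans (ler_norm_sum _ _ _) _; apply: ler_sum => U _.
rewrite -mulrBr normrM ger0_norm ?pr_ge0 // [X in _ <= X]mulrCA distrC.
by apply: ler_wpM2l; [apply: pr_ge0 | apply: bonferroni_ineq].
Qed.

Lemma atleast_k_trunc_cvg k :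
  (fun n => pr (atleast_k_trunc n k)) @ \oo --> pr (atleast_k A k).
Proof.
have atleast_kE : atleast_k A k = \bigcup_n atleast_k_trunc n k.
  rewrite /atleast_k -bigcup_incr_tuples_le; apply/seteqP.
  split => [x [t [n _ t_le] xt] | x [n _ [t t_le xt]]]; first by exists n => //; exists t.
  by exists t => //; exists n.
have ndP : nondecreasing_seq (fun n => atleast_k_trunc n k).
  move=> n m le_nm; apply/subsetPset => x [t t_le xt]; exists t => //.
  by have /subsetPset := nondecreasing_incr_tuples_le k _ _ le_nm; apply.
have mU : measurable (\bigcup_n atleast_k_trunc n k).
  by apply: bigcupT_measurable => n; apply: measurable_atleast_k_trunc.
apply: fine_cvg; rewrite atleast_kE -prE //.
by apply: nondecreasing_cvg_mu => // n; apply: measurable_atleast_k_trunc.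
Qed.

End Truncation.

Lemma squeeze_cvg0_iff {R : realFieldType} (u v : nat -> R) (c : R) :
  (forall n, 0 <= u n) -> (forall n, u n <= v n) -> (forall n, v n <= c * u n) ->
  u @ \oo --> 0 <-> v @ \oo --> 0.
Proof.
move=> u_ge0 le_uv le_vcu; split => [u0 | v0].
  apply: (@squeeze_cvgr _ _ _ _ (fun=> 0) (fun n => c * u n)); last first.
  - by rewrite -(mulr0 c); apply: cvgMl_tmp.
  - exact: cvg_cst.
  - by apply: nearW => n; rewrite (le_trans (u_ge0 n) (le_uv n)) le_vcu.
apply: (@squeeze_cvgr _ _ _ _ (fun=> 0) v) => //; last exact: cvg_cst.
by apply: nearW => n; rewrite u_ge0 le_uv.
Qed.

Section Series.
Context {d} {T : measurableType d} {R : realType} (P : probability T R) (A : nat -> set T).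
Hypothesis mA : forall i, measurable (A i).
Variable K : nat.
Hypothesis Sk_fin : forall l, (0 < l)%N -> Sk P A l \is a fin_num.

Definition bonferroni_series J : R :=
  \sum_(0 <= j < J) (-1) ^+ j * 'C(j + K, K)%:R * fine (Sk P A (j + K.+1)%N).

Lemma bonferroni_series_bound J :
  `|bonferroni_series J - pr P (atleast_k A K.+1)|
    <= 'C(J + K, K)%:R * fine (Sk P A (J + K.+1)%N).
Proof.
have Sk_trunc_cvgS j : Sk_trunc P A ^~ (j + K.+1)%N @ \oo --> fine (Sk P A (j + K.+1)%N).
  by apply/(Sk_trunc_cvg P A mA)/Sk_fin; rewrite addnS.
have partial_cvg : (fun n => \sum_(0 <= j < J)
    (-1) ^+ j * 'C(j + K, K)%:R * Sk_trunc P A n (j + K.+1)%N) @ \oo --> bonferroni_series J.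
  rewrite /bonferroni_series; elim: J => [|J IHJ].
    by under eq_fun do rewrite big_nil; rewrite big_nil; apply: cvg_cst.
  under eq_fun do rewrite big_nat_recr //=.
  by rewrite big_nat_recr //=; apply: cvgD => //; apply: cvgMl_tmp.
apply: (ler_cvg_to (cvg_norm (cvgB partial_cvg (atleast_k_trunc_cvg P A mA K.+1))) (cvg_cst _)).
apply: nearW => n; apply: le_trans (bonferroni_trunc P A mA n K J) _.
apply: ler_wpM2l => //; rewrite -lee_fin fineK; last by apply: Sk_fin; rewrite addnS.
rewrite -(fsum_incr_tuples_le P A mA) /Sk; apply: esum_ge.
exists (incr_tuples_le n (J + K.+1)%N) => //.
by split; [apply: finite_incr_tuples_le | move=> t []].
Qed.

Lemma Sk_ge0 l : (0 <= Sk P A l)%E.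
Proof. by apply: esum_ge0 => t _; apply: measure_ge0. Qed.

Lemma weighted_Sk_cvg0E :
  (fun l => (((l%:R : R) ^+ K)%:E * Sk P A l)%E) @ \oo --> 0%E <->
  (fun j => 'C(j + K, K)%:R * fine (Sk P A (j + K.+1)%N)) @ \oo --> 0.
Proof.
rewrite -[X in X <-> _](cvg_shiftn K.+1) /=.
have -> : (fun j => ((((j + K.+1)%N%:R : R) ^+ K)%:E * Sk P A (j + K.+1)%N)%E) =
    (fun j => ((j + K.+1)%N%:R ^+ K * fine (Sk P A (j + K.+1)%N))%:E).
  by apply/funext => j; rewrite EFinM fineK //; apply: Sk_fin; rewrite addnS.
have s_ge0 j : 0 <= fine (Sk P A (j + K.+1)%N) by apply/fine_ge0/Sk_ge0.
have C_Sk_equiv : (fun j => 'C(j + K, K)%:R * fine (Sk P A (j + K.+1)%N)) @ \oo --> 0 <->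
    (fun j => (j + K.+1)%N%:R ^+ K * fine (Sk P A (j + K.+1)%N)) @ \oo --> 0.
  apply: (squeeze_cvg0_iff _ _ (K.+1 ^ K * K`!)%N%:R) => j.
  - exact: mulr_ge0.
  - by apply: ler_wpM2r => //; rewrite -natrX ler_nat bin_le_expn.
  - by rewrite mulrA -natrM; apply: ler_wpM2r => //; rewrite -natrX ler_nat expn_le_bin.
split => [/fine_cvg /C_Sk_equiv // | /C_Sk_equiv C_Sk0].
by apply: cvg_EFin; first apply: nearW.
Qed.

Lemma bonferroni_terms_cvg0 : cvgn bonferroni_series ->
  (fun j => 'C(j + K, K)%:R * fine (Sk P A (j + K.+1)%N)) @ \oo --> 0.
Proof.
pose u j := (-1) ^+ j * 'C(j + K, K)%:R * fine (Sk P A (j + K.+1)%N).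
move=> /(@cvg_series_cvg_0 _ _ u) /(iffRL (norm_cvg0P _)).
apply: cvg_trans; apply: near_eq_cvg; apply: nearW => j /=.
by rewrite /u -mulrA normrM normr_sign mul1r ger0_norm // mulr_ge0 // fine_ge0 // Sk_ge0.
Qed.

Lemma bonferroni_series_cvg :
  (fun j => 'C(j + K, K)%:R * fine (Sk P A (j + K.+1)%N)) @ \oo --> 0 ->
  bonferroni_series @ \oo --> pr P (atleast_k A K.+1).
Proof.
move=> C_Sk0; apply/subr_cvg0/norm_cvg0P.
apply: (@squeeze_cvgr _ _ _ _ (fun=> 0) _ _ _ _ (cvg_cst _) C_Sk0).
by apply: nearW => J; rewrite normr_ge0 bonferroni_series_bound.
Qed.

End Series.

Theorem theorem1p1 (d : measure_display) (T : measurableType d) (R : realType)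
  (P : probability T R) (A : nat -> set T) (mA : forall i, measurable (A i))
  (k : nat) (hk : (0 < k)%N) :
  ((forall l : nat, (0 < l)%N -> Sk P A l \is a fin_num) /\
   (fun n : nat => \sum_(0 <= j < n)
        ((-1) ^+ j * ('C(j + k - 1, k - 1))%:R * fine (Sk P A (j + k)) : R))
     @ \oo --> fine (P (atleast_k A k)))
  <->
  ((forall l : nat, (0 < l)%N -> Sk P A l \is a fin_num) /\
   (fun l : nat => (((l%:R : R) ^+ (k - 1))%:E * Sk P A l)%E) @ \oo --> 0%E).
Proof.
case: k hk => [//|K] _; rewrite subn1 /=.
have -> : (fun n => \sum_(0 <= j < n)
    ((-1) ^+ j * 'C(j + K.+1 - 1, K)%:R * fine (Sk P A (j + K.+1)) : R)) = bonferroni_series P A K.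
  by apply/funext => n; apply: eq_bigr => j _; rewrite addnS subn1.
split => -[Sk_fin series_cvg]; split => //.
  apply/(weighted_Sk_cvg0E P A K Sk_fin)/(bonferroni_terms_cvg0 P A K).
  by apply/cvgP: series_cvg.
by apply/(bonferroni_series_cvg P A mA K Sk_fin)/(weighted_Sk_cvg0E P A K Sk_fin).
Qed.
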